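(* Let $\mathfrak{M}\subseteq\mathbb{R}^n$ be a nonempty closed set and let $\ell\in C(\mathbb{R}^n)$ be bounded, with $\ell(x)>0$ for $x\in\mathbb{R}^n\setminus\mathfrak{M}$ and $\ell\equiv0$ on $\mathfrak{M}$. Let $v(x)=\inf_\alpha\int_0^{t_x(\alpha)}\ell(y_x^\alpha(s))\,ds$. Let $x\in\mathbb{R}^n$ and let $\alpha$ be an admissible control with corresponding trajectory $y(\cdot)=y_x^\alpha(\cdot)$. Then $\alpha$ is optimal (for the initial point $x$) if and only if $$\dot y(s)\in\Big\{-\frac{p}{|p|}\,:\ p\in D^-v(y(s))\Big\}\qquad\text{for a.e. }s\in(0,t_x(\alpha)).$$
   Context: An admissible control is a measurable function $\alpha:[0,+\infty)\to B(0,1)$, where $B(0,1)$ is the closed unit ball of $\mathbb{R}^n$. Its trajectory from $x$ is $y_x^\alpha(t)=x+\int_0^t\alpha(s)\,ds$, and its hitting time is $t_x(\alpha)=\inf\{s\ge0: y_x^\alpha(s)\in\mathfrak{M}\}\in[0,+\infty]$. The infimum defining $v(x)$ is over admissible controls; $\alpha$ is optimal for $x$ if $\int_0^{t_x(\alpha)}\ell(y_x^\alpha(s))\,ds=v(x)$. The subdifferential of a continuous function $v$ at $z$ is $$D^-v(z)=\Big\{p\in\mathbb{R}^n:\ \liminf_{x\to z}\frac{v(x)-v(z)-p\cdot(x-z)}{|x-z|}\ge0\Big\}.$$ *)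

(* Defs.v *)
From HB Require Import structures.
From mathcomp Require Import all_boot all_order all_algebra.
From mathcomp Require Import all_classical all_reals all_analysis.

Set Implicit Arguments.
Unset Strict Implicit.
Unset Printing Implicit Defensive.

Import Order.TTheory GRing.Theory Num.Theory.
Import numFieldNormedType.Exports.

Local Open Scope classical_set_scope.
Local Open Scope ring_scope.

(* The library norm `|x| on 'rV[R]_n is the sup norm, so the Euclidean one is
   defined here; the topology of 'rV[R]_n is the same for both. *)
Definition dot (R : realType) (n : nat) (u w : 'rV[R]_n) : R :=
  \sum_(i < n) u 0 i * w 0 i.

Definition enorm (R : realType) (n : nat) (u : 'rV[R]_n) : R :=
  Num.sqrt (dot u u).

(* R with the sigma-algebra of Lebesgue measurable sets (the default one on R
   is the Borel sigma-algebra). *)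
Notation lebesgueR R := (caratheodory_type (@wlength R idfun)^*%mu).

Notation lebesgue R := (@completed_lebesgue_measure R).

Section Control.
Variables (R : realType) (n : nat).
Implicit Types (x z : 'rV[R]_n) (a : R -> 'rV[R]_n).

Definition admissible a : Prop :=
  (forall i, measurable_fun ([set s | 0 <= s] : set (lebesgueR R))
               (fun s : lebesgueR R => a s 0 i)) /\
  (forall s, 0 <= s -> enorm (a s) <= 1).

Definition trajectory x a (t : R) : 'rV[R]_n :=
  x + \row_i (\int[lebesgue R]_(s in [set s | 0 <= s <= t]) (a s 0 i)).

(* Equal to +oo when the trajectory never meets M. *)
Definition hitting_time (M : set 'rV[R]_n) x a : \bar R :=
  ereal_inf [set s%:E | s in [set s : R | 0 <= s /\ M (trajectory x a s)]].

Definition cost (M : set 'rV[R]_n) (l : 'rV[R]_n -> R) x a : \bar R :=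
  (\int[lebesgue R]_(s in [set s : R | (0 <= s)%R /\ s%:E < hitting_time M x a])
     (l (trajectory x a s))%:E)%E.

Definition value (M : set 'rV[R]_n) (l : 'rV[R]_n -> R) x : \bar R :=
  ereal_inf [set cost M l x a | a in admissible].

Definition optimal (M : set 'rV[R]_n) (l : 'rV[R]_n -> R) x a : Prop :=
  cost M l x a = value M l x.

Definition subdiff (u : 'rV[R]_n -> R) z : set 'rV[R]_n :=
  [set p | (0 <= limf_einf
     (fun x => ((u x - u z - dot p (x - z)) / enorm (x - z))%:E) z^')%E].

(* -p/|p| only makes sense for p <> 0, hence the explicit condition. *)
Definition descent_directions (u : 'rV[R]_n -> R) z : set 'rV[R]_n :=
  [set - (enorm p)^-1 *: p | p in [set p | subdiff u z p /\ p != 0]].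

End Control.

(* Main.v *)
Require Import Defs.
From HB Require Import structures.
From mathcomp Require Import all_boot all_order all_algebra.
From mathcomp Require Import all_classical all_reals all_analysis.
From mathcomp Require Import measurable_realfun.
From mathcomp Require Import lra.

(* The trajectories form a class of 1-Lipschitz curves closed under time shift
   and concatenation, which yields the dynamic programming inequalities for
   the value function v.

   If y follows descent directions, then g(s) = v(y(s)) + int_0^s l(y) is
   Lipschitz, and since |p| >= l for every subgradient p of v outside M, the
   left difference quotients of g are asymptotically nonpositive at almost
   every s. Hence g is nonincreasing, so the running cost never exceeds
   v(x) as v >= 0. Infinite hitting times need no separate treatment.

   If y is optimal, then v(y(r)) - v(y(s)) = int_r^s l(y) for r < s. Leaving
   y at time r along the segment to a nearby point w costs about
   l(y(s)) |w - y(r)|. Letting s - r be a large multiple of |w - y(s)|, so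
   that |w - y(r)| is affine in w up to a small error, this shows that
   -l(y(s)) y'(s) is a subgradient wherever y is differentiable; the case
   w = y(s) shows that |y'(s)| = 1. *)

Set Implicit Arguments.
Unset Strict Implicit.
Unset Printing Implicit Defensive.

Import Order.TTheory GRing.Theory Num.Theory.
Import numFieldNormedType.Exports.

Local Open Scope classical_set_scope.
Local Open Scope ring_scope.

(** * Euclidean norm *)

Section euclidean.
Context {R : realType} {n : nat}.
Implicit Types (u w z : 'rV[R]_n) (c : R).

Lemma dotC u w : dot u w = dot w u.
Proof. by apply: eq_bigr => i _; rewrite mulrC. Qed.

Lemma dotDl u w z : dot (u + w) z = dot u z + dot w z.
Proof. by rewrite -big_split; apply: eq_bigr => i _; rewrite mxE mulrDl. Qed.

Lemma dotZl c u z : dot (c *: u) z = c * dot u z.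
Proof. by rewrite mulr_sumr; apply: eq_bigr => i _; rewrite mxE mulrA. Qed.

Lemma dotNl u z : dot (- u) z = - dot u z.
Proof. by rewrite -scaleN1r dotZl mulN1r. Qed.

Lemma dotBl u w z : dot (u - w) z = dot u z - dot w z.
Proof. by rewrite dotDl dotNl. Qed.

Lemma dotDr u w z : dot z (u + w) = dot z u + dot z w.
Proof. by rewrite dotC dotDl !(dotC z). Qed.

Lemma dotZr c u z : dot z (c *: u) = c * dot z u.
Proof. by rewrite dotC dotZl dotC. Qed.

Lemma dotNr u z : dot z (- u) = - dot z u.
Proof. by rewrite dotC dotNl dotC. Qed.

Lemma dotBr u w z : dot z (u - w) = dot z u - dot z w.
Proof. by rewrite dotDr dotNr. Qed.

Lemma dotr0 u : dot u 0 = 0.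
Proof. by rewrite -(subrr u) dotBr subrr. Qed.

Lemma dot_ge0 u : 0 <= dot u u.
Proof. by apply: sumr_ge0 => i _; rewrite -expr2 sqr_ge0. Qed.

Lemma enorm_ge0 u : 0 <= enorm u.
Proof. exact: sqrtr_ge0. Qed.
Hint Resolve enorm_ge0 : core.

Lemma enorm_sqr u : enorm u ^+ 2 = dot u u.
Proof. by rewrite sqr_sqrtr// dot_ge0. Qed.

Lemma le_coord_enorm u i : `|u 0 i| <= enorm u.
Proof.
rewrite -(@ler_pXn2r _ 2)// ?nnegrE// enorm_sqr real_normK ?num_real//.
rewrite /dot (bigD1 i)//= -expr2 lerDl.
by apply: sumr_ge0 => j _; rewrite -expr2 sqr_ge0.
Qed.

Lemma enorm_eq0 u : (enorm u == 0) = (u == 0).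
Proof.
apply/eqP/eqP => [u0|->]; last first.
  by rewrite /enorm /dot big1 ?sqrtr0// => i _; rewrite mxE mul0r.
apply/rowP => i; rewrite mxE; apply/eqP.
by rewrite -normr_le0 -u0 le_coord_enorm.
Qed.

Lemma enorm0 : enorm (0 : 'rV[R]_n) = 0.
Proof. by apply/eqP; rewrite enorm_eq0. Qed.

Lemma enorm_gt0 u : (0 < enorm u) = (u != 0).
Proof. by rewrite lt_neqAle enorm_ge0 andbT eq_sym enorm_eq0. Qed.

Lemma enormZ c u : enorm (c *: u) = `|c| * enorm u.
Proof.
by rewrite /enorm dotZl dotZr mulrA -expr2 sqrtrM ?sqr_ge0// sqrtr_sqr.
Qed.

Lemma enormN u : enorm (- u) = enorm u.
Proof. by rewrite -scaleN1r enormZ normrN1 mul1r. Qed.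

Lemma enormC u w : enorm (u - w) = enorm (w - u).
Proof. by rewrite -enormN opprB. Qed.

(** Cauchy-Schwarz: for nonzero vectors, expanding the square of [enorm w *: u - enorm u *: w] and
    dividing by twice the product of the norms. *)
Lemma le_dot_enorm u w : dot u w <= enorm u * enorm w.
Proof.
have [->|u0] := eqVneq u 0.
  by rewrite enorm0 mul0r -(scale0r 0) dotZl mul0r.
have [->|w0] := eqVneq w 0.
  by rewrite enorm0 mulr0 -(scale0r 0) dotZr mul0r.
have := dot_ge0 (enorm w *: u - enorm u *: w).
rewrite dotBl !dotBr !dotZl !dotZr -!enorm_sqr (dotC w u).
move: u0 w0; rewrite -!enorm_gt0.
move: (enorm u) (enorm w) (dot u w) => a b d a0 b0 h.
have {h}: 0 <= (a * b) * (a * b - d) by lra.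
by rewrite pmulr_rge0 ?mulr_gt0// subr_ge0.
Qed.

Lemma enorm_triangle u w : enorm (u + w) <= enorm u + enorm w.
Proof.
rewrite -(@ler_pXn2r _ 2)// ?nnegrE ?addr_ge0// enorm_sqr dotDl !dotDr.
rewrite sqrrD !enorm_sqr (dotC w u); have := le_dot_enorm u w; lra.
Qed.

Lemma enorm_distD z u w : enorm (u - w) <= enorm (u - z) + enorm (z - w).
Proof. by rewrite (le_trans _ (enorm_triangle _ _))// addrA subrK. Qed.

Lemma norm_le_enorm u : `|u| <= enorm u.
Proof.
have [->|u0] := eqVneq u 0; first by rewrite normr0.
have [|[i j] ui] := @mx_norm_neq0 _ _ _ u; first by apply/eqP => /mx_norm_eq0; exact/eqP.
by rewrite [leLHS]ui /= ord1 le_coord_enorm.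
Qed.

Lemma coord_le_norm u i : `|u 0 i| <= `|u|.
Proof.
rewrite [leRHS]/Num.norm/= mx_normrE.
by apply: le_trans (le_bigmax _ _ (0, i)) => /=.
Qed.

Lemma enorm_le_norm u : enorm u <= Num.sqrt n%:R * `|u|.
Proof.
rewrite -(@ler_pXn2r _ 2)// ?nnegrE ?mulr_ge0// enorm_sqr.
rewrite exprMn sqr_sqrtr// mulrC mulr_natr.
have -> : `|u| ^+ 2 *+ n = \sum_(i < n) `|u| ^+ 2 by rewrite sumr_const card_ord.
apply: ler_sum => i _.
by rewrite -expr2 -real_normK ?num_real// ler_pXn2r ?nnegrE// coord_le_norm.
Qed.

End euclidean.
#[global] Hint Extern 0 (is_true (0 <= enorm _)) => exact: enorm_ge0 : core.

(** * Lebesgue integrals over intervals *)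

Section change_of_measure.
Context {R : realType}.
Notation mu := (@lebesgue_measure R).
Local Open Scope ereal_scope.

(** Splitting [f] into positive and negative parts reduces the formula to nonnegative integrands. It
    serves twice: with the identity from Lebesgue to Borel measurable sets, and with
    translations. *)
Lemma integral_image_measure d1 d2 (X : measurableType d1)
    (Y : measurableType d2) (phi : X -> Y)
    (nuX : {measure set X -> \bar R}) (nuY : {measure set Y -> \bar R})
    (D : set Y) (f : Y -> \bar R) : measurable_fun [set: X] phi ->
  (forall A, measurable A -> nuY A = nuX (phi @^-1` A)) ->
  measurable D -> measurable_fun [set: Y] f ->
  \int[nuY]_(y in D) f y = \int[nuX]_(x in phi @^-1` D) (f \o phi) x.
Proof.
move=> mphi nuE mD mf; have mfD : measurable_fun D f by exact: measurable_funTS.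
transitivity (\int[pushforward nuX phi]_(y in D) f y).
  by apply: eq_measure_integral => // A mA _; exact: nuE.
rewrite [LHS]integralE [RHS]integralE.
rewrite (ge0_integral_pushforward mphi _ mD (measurable_funepos mfD))//.
rewrite (ge0_integral_pushforward mphi _ mD (measurable_funeneg mfD))//.
by rewrite (funepos_comp f phi) (funeneg_comp f phi).
Qed.

Lemma measurable_id_lebesgueR :
  measurable_fun setT (id : lebesgueR R -> measurableTypeR R).
Proof. by move=> _ A mA; rewrite setTI; exact: sub_caratheodory. Qed.

Lemma integral_lebesgueR (D : set R) (f : R -> \bar R) :
  measurable D -> measurable_fun [set: R] f ->
  \int[lebesgue R]_(s in D) f s = \int[mu]_(s in D) f s.
Proof.
move=> mD mf; apply/esym.
exact: (integral_image_measure (phi := id : lebesgueR R -> measurableTypeR R)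
  measurable_id_lebesgueR _ mD mf).
Qed.

(** By uniqueness it suffices to compare both measures on half-open intervals. *)
Lemma lebesgue_measureD (c : R) (A : set R) : measurable A ->
  pushforward mu (+%R^~ c : R -> measurableTypeR R) A = mu A.
Proof.
move=> mA; apply/esym/lebesgue_measure_unique => //=.
  by apply: measurable_funD; [exact: measurable_id|exact: measurable_cst].
move=> mphi _ [[a b]] _ <-.
rewrite /pushforward (_ : _ @^-1` _ = `](a - c)%R, (b - c)%R]%classic).
  rewrite !lebesgue_measure_itv/= !lte_fin ltrD2r.
  by rewrite -!EFinB opprB addrA subrK.
by apply/seteqP; split => s /=; rewrite !in_itv/= ltrBlDr lerBrDr.
Qed.

End change_of_measure.

Section bounded_measurable.
Context {R : realType}.
Notation mu := (@lebesgue_measure R).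
Implicit Types f g : R -> R.

(** A class containing the coordinates of controls and the running cost along continuous curves; its
    members are integrable on every compact interval. *)
Definition bounded_measurable f :=
  measurable_fun [set: R] f /\ exists K, forall x, `|f x| <= K.

Lemma bounded_measurable_integrable f s t : bounded_measurable f ->
  mu.-integrable `[s, t] (EFin \o f).
Proof.
move=> [mf [K fK]]; apply: measurable_bounded_integrable => //.
- by rewrite /= lebesgue_measure_itv/=; case: ifP => // _; rewrite -EFinB ltry.
- exact: measurable_funTS.
- exists K; split; first exact: num_real.
  by move=> M KM x _ /=; rewrite (le_trans (fK x))// ltW.
Qed.

Lemma Rintegral_itv_split f u s t : bounded_measurable f -> s <= u <= t ->
  \int[mu]_(r in `[s, t]) f r =
  \int[mu]_(r in `[s, u]) f r + \int[mu]_(r in `[u, t]) f r.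
Proof.
move=> bf /andP[su ut].
rewrite -(@Rintegral_itv_obnd_cbnd _ u); last first.
  by apply: integrableS (bounded_measurable_integrable u t bf) => //;
    exact: subset_itv_oc_cc.
rewrite -(@Rintegral_itvB _ _ _ _ u (bounded_measurable_integrable s t bf)) ?bnd_simp//.
by rewrite addrC subrK.
Qed.

Lemma Rintegral_translate f c s t : bounded_measurable f ->
  \int[mu]_(r in `[s + c, t + c]) f r = \int[mu]_(r in `[s, t]) f (r + c).
Proof.
move=> [mf _]; congr fine.
rewrite (integral_image_measure (nuX := mu)
  (phi := +%R^~ c : measurableTypeR R -> measurableTypeR R)) //.
- congr (integral _ _ _); apply/seteqP; split => r /=;
  by rewrite !in_itv/= !lerD2r.
- by apply: measurable_funD; [exact: measurable_id|exact: measurable_cst].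
- by move=> A mA; exact/esym/lebesgue_measureD.
- exact/measurable_EFinP.
Qed.

Lemma Rintegral_itv_cst (c s t : R) : s <= t ->
  \int[mu]_(r in `[s, t]) c = c * (t - s).
Proof.
move=> st; rewrite Rintegral_cst//=.
rewrite lebesgue_measure_itv/= lte_fin; case: ltP => [//|ts].
have -> : t = s by apply/le_anti; rewrite st ts.
by rewrite subrr.
Qed.

Lemma bounded_measurable_cst c : bounded_measurable (cst c).
Proof. by split; [exact: measurable_cst|exists `|c|]. Qed.

Lemma Rintegral_itv_ub f (c s t : R) : bounded_measurable f -> s <= t ->
  (forall r, s <= r <= t -> f r <= c) ->
  \int[mu]_(r in `[s, t]) f r <= c * (t - s).
Proof.
move=> bf st fc; rewrite -Rintegral_itv_cst//; apply: le_Rintegral => //.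
- exact: bounded_measurable_integrable.
- exact: (bounded_measurable_integrable s t (bounded_measurable_cst c)).
Qed.

Lemma Rintegral_itv_lb f (c s t : R) : bounded_measurable f -> s <= t ->
  (forall r, s <= r <= t -> c <= f r) ->
  c * (t - s) <= \int[mu]_(r in `[s, t]) f r.
Proof.
move=> bf st fc; rewrite -Rintegral_itv_cst//; apply: le_Rintegral => //.
- exact: (bounded_measurable_integrable s t (bounded_measurable_cst c)).
- exact: bounded_measurable_integrable.
Qed.

Lemma bounded_measurable_sum (I : Type) (q : seq I) (c : I -> R)
    (F : I -> R -> R) : (forall i, bounded_measurable (F i)) ->
  bounded_measurable (fun r => \sum_(i <- q) c i * F i r) /\
  forall s t, \int[mu]_(r in `[s, t]) (\sum_(i <- q) c i * F i r) =
    \sum_(i <- q) c i * \int[mu]_(r in `[s, t]) F i r.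
Proof.
move=> bF; elim: q => [|i q [[mq [K qK]] Iq]].
  have -> : (fun r => \sum_(i <- [::]) c i * F i r) = cst 0.
    by apply/funext => r; rewrite big_nil.
  split=> [|s t]; first exact: bounded_measurable_cst.
  rewrite big_nil Rintegral_cst ?mul0r//.
have -> : (fun r => \sum_(j <- i :: q) c j * F j r) =
    (fun r => c i * F i r + \sum_(j <- q) c j * F j r).
  by apply/funext => r; rewrite big_cons.
have bi : bounded_measurable (fun r => c i * F i r).
  have [mi [L iL]] := bF i; split.
    by apply: measurable_funM => //; exact: measurable_cst.
  by exists (`|c i| * L) => x; rewrite normrM ler_wpM2l.
have bq : bounded_measurable (fun r => \sum_(j <- q) c j * F j r).
  by split => //; exists K.
split=> [|s t].
  split; first by apply: measurable_funD => //; exact: bi.1.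
  have [_ [L iL]] := bi; exists (L + K) => x.
  by rewrite (le_trans (ler_normD _ _))// lerD.
rewrite RintegralD//; last 2 first.
- exact: bounded_measurable_integrable.
- exact: bounded_measurable_integrable.
rewrite RintegralZl//; last exact: bounded_measurable_integrable.
by rewrite big_cons Iq.
Qed.

End bounded_measurable.

(** * Curves driven by admissible controls *)

Section borel_modification.
Context {R : realType}.
Notation mu := (@lebesgue_measure R).
Implicit Types f g : R -> R.

Lemma measurable_fun_restrict_borel f (D : set R) : measurable D ->
  measurable_fun [set: R] f -> measurable_fun [set: R] (f \_ D).
Proof.
by move=> mD mf; exact: ((measurable_restrictT f mD).1 (measurable_funTS mf)).
Qed.

(** The Lebesgue sigma-algebra is the completion of the Borel one, so [A] is a Borel set joined with
    a part of a Borel null set; removing that null set leaves only Borel data. *)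
Lemma caratheodory_borel (A : set (lebesgueR R)) : measurable A ->
  exists B N : set R, [/\ measurable B, measurable N, mu N = 0%E &
    A `\` N = B `\` N].
Proof.
move=> mA.
have : (completed_algebra_gen mu).-sigma.-measurable A.
  by rewrite completed_caratheodory_measurable.
rewrite g_sigma_completed_algebra_genE => -[B mB [N0 [N [mN N00 N0N]]] BA].
exists B, N; split => //; rewrite -BA.
apply/seteqP; split => x [h Nx]; split => //; last by left.
by case: h => // /N0N.
Qed.

Lemma rat_enumeration : exists e : nat -> rat, forall q, exists k, e k = q.
Proof.
exists (fun k => odflt 0 (@unpickle rat k)) => q.
by exists (pickle q); rewrite pickleK.
Qed.

(** Rational levels suffice because each []r, +oo[] is a countable union of rational half-lines.
    This leaves only countably many null sets to discard in [borel_modification]. *)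
Lemma measurable_fun_gt_rat g :
  (forall q : rat, measurable [set x | ratr q < g x]) ->
  measurable_fun [set: R] g.
Proof.
move=> mg; apply: (measurability _ (RGenOInfty.measurableE R)) => //.
have [e eq] := rat_enumeration.
move=> /= _ [_ [r ->] <-]; rewrite setTI.
have -> : g @^-1` `]r, +oo[ =
    \bigcup_(k in [set k | r < ratr (e k)]) [set x | ratr (e k) < g x].
  apply/seteqP; split => x /=; rewrite in_itv/= andbT.
    move=> /rat_in_itvoo[q]; rewrite in_itv/= => /andP[rq qg].
    by have [k ekq] := eq q; exists k; rewrite /= ekq.
  by move=> [k /= rk]; exact: lt_trans.
by apply: bigcup_measurable => k _; exact: mg.
Qed.

(* Lebesgue's differentiation theorem is available for Borel functions only,
   whereas controls are merely Lebesgue measurable. *)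
Lemma borel_modification (f : lebesgueR R -> R) : measurable_fun setT f ->
  exists N : set R, [/\ measurable N, mu N = 0%E &
    measurable_fun [set: R] ((f : R -> R) \_ (~` N))].
Proof.
move=> mf.
have : forall q : rat, exists BN : set R * set R,
    [/\ measurable BN.1, measurable BN.2, mu BN.2 = 0%E &
      [set x | ratr q < f x] `\` BN.2 = BN.1 `\` BN.2].
  move=> q; have [|B [N BN]] := @caratheodory_borel [set x | ratr q < f x].
    rewrite -[X in measurable X]setTI.
    rewrite (_ : [set x | _] = f @^-1` `](ratr q), +oo[%classic).
      by apply: mf => //; exact: measurable_itv.
    by apply/seteqP; split => x /=; rewrite in_itv/= andbT.
  by exists (B, N).
move=> /choice[BN BNP].
have [e eq] := rat_enumeration.
pose N := \bigcup_k (BN (e k)).2.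
have BNN q : (BN q).2 `<=` N.
  by move=> x Nx; have [k ekq] := eq q; exists k; rewrite ?ekq.
have mN : measurable N.
  by apply: bigcupT_measurable => k; have [] := BNP (e k).
exists N; split => //.
  apply/negligibleP => //; apply: negligible_bigcup => k.
  have [_ m0 N0 _] := BNP (e k).
  by exists (BN (e k)).2; split.
apply: measurable_fun_gt_rat => q.
have [mB mNq _ BE] := BNP q.
have BE' : [set x | ratr q < f x] `\` N = (BN q).1 `\` N.
  have -> : N = (BN q).2 `|` N by apply/esym/setUidPr/BNN.
  by rewrite -!setDDl BE.
(* On [N] the restricted function takes the default value 0, so that part of the superlevel set is
   all of [N] or empty, according to the sign of the level. *)
have -> : [set x | ratr q < ((f : R -> R) \_ (~` N)) x] =
    ((BN q).1 `\` N) `|` (N `&` [set _ | ratr q < (0 : R)]).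
  rewrite -BE'; apply/seteqP; split => x /=; rewrite patchE.
    case: ifPn => [|]; first by rewrite inE; left.
    by rewrite notin_setE/= => /contrapT; right.
  case=> [[fx Nx]|[Nx q0]]; first by rewrite ifT// inE.
  by rewrite ifF//; apply/negbTE; rewrite notin_setE/= => /(_ Nx).
apply: measurableU; first exact: measurableD.
apply: measurableI => //; case: (ratr q < 0).
- by rewrite (_ : [set _ | _] = setT)//; apply/seteqP; split=> x.
- by rewrite (_ : [set _ | _] = set0)//; apply/seteqP; split=> x.
Qed.

End borel_modification.

(** * Borel controls and their displacements *)

Section curves.
Context {R : realType} {n : nat}.
Notation mu := (@lebesgue_measure R).
Implicit Types (b : R -> 'rV[R]_n) (z w : 'rV[R]_n).

(** Both conditions are imposed at all real times, so that translating a control in time stays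
    within the class. *)
Definition borel_control b :=
  (forall i, measurable_fun [set: R] (fun s => b s 0 i)) /\
  forall s, enorm (b s) <= 1.

Definition displacement b s t : 'rV[R]_n :=
  \row_i \int[mu]_(r in `[s, t]) b r 0 i.

Lemma borel_control_coord b i : borel_control b ->
  bounded_measurable (fun s => b s 0 i).
Proof.
move=> [mb b1]; split; first exact: mb.
by exists 1 => s; rewrite (le_trans (le_coord_enorm _ _)).
Qed.

Lemma borel_control_admissible b z : borel_control b ->
  admissible b /\ trajectory z b = fun t => z + displacement b 0 t.
Proof.
move=> bb; split.
  split=> [i|s _]; last exact: bb.2.
  apply: (@measurable_funTS _ _ (lebesgueR R) _ _ (fun s => b s 0 i)).
  move=> _ Y mY; rewrite setTI; apply: sub_caratheodory.
  by rewrite -[X in measurable X]setTI; exact: bb.1.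
apply/funext => t; congr (_ + _); apply/rowP => i; rewrite !mxE.
congr fine; rewrite (_ : [set s | 0 <= s <= t] = `[0, t]%classic).
  rewrite integral_lebesgueR//; by apply/measurable_EFinP; exact: (bb.1 i).
by apply/seteqP; split => s /=; rewrite in_itv.
Qed.

(** Setting [a] to 0 at negative times and on a null set outside which its coordinates are Borel
    does not change its integrals over [[0, t]]. *)
Lemma admissible_borel_control (a : R -> 'rV[R]_n) : admissible a ->
  exists2 b, borel_control b &
    forall z, trajectory z a = fun t => z + displacement b 0 t.
Proof.
move=> [ma a1].
pose D : set R := [set s | 0 <= s].
have DE : D = `[0, +oo[%classic.
  by apply/seteqP; split => s; rewrite /D /= in_itv/= andbT.
have mD : measurable (D : set (lebesgueR R)).
  by rewrite DE; apply: sub_caratheodory; exact: measurable_itv.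
pose f i : lebesgueR R -> R := (fun s : lebesgueR R => a s 0 i) \_ D.
have mf i : measurable_fun setT (f i).
  exact: ((measurable_restrictT (fun s : lebesgueR R => a s 0 i) mD).1 (ma i)).
have /choice[N NP] := fun i => borel_modification (mf i).
(* The finite family [N] is turned into a sequence, with the empty set beyond [n], to apply results
   on countable unions. *)
pose N' (k : nat) := oapp N set0 (insub k : option 'I_n).
pose NN := \bigcup_k N' k.
have mN' k : measurable (N' k).
  by rewrite /N'; case: insub => //= i; have [] := NP i.
have NNi i : N i `<=` NN by move=> s Ns; exists (val i) => //; rewrite /N' valK.
have mNN : measurable NN by exact: bigcupT_measurable.
have NN0 : mu.-negligible NN.
  apply: negligible_bigcup => k; exists (N' k); split => //; first exact: mN'.
  by rewrite /N'; case: insub => //= i; have [] := NP i.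
pose b (s : R) : 'rV[R]_n := if s \in D `\` NN then a s else 0.
have bE i : (fun s => b s 0 i) = ((f i : R -> R) \_ (~` N i)) \_ (~` NN).
  apply/funext => s; rewrite /b !patchE.
  have [sD|sD] := boolP (s \in D); last first.
    rewrite ifF; last first.
      by apply/negbTE; move: sD; rewrite !notin_setE => h [].
    rewrite mxE; do 2 case: ifP => // _.
    by rewrite /f patchE ifF//; exact/negbTE.
  have [sN|sN] := boolP (s \in ~` NN); last first.
    rewrite ifF ?mxE//; apply/negbTE; move: sN; rewrite !notin_setE => h [].
    by move=> _ /h.
  rewrite ifT; last by move: sN sD; rewrite !inE.
  rewrite ifT; last first.
    by move: sN; rewrite !inE => sN /NNi.
  by rewrite /f patchE ifT.
have bb : borel_control b.
  split=> [i|s].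
    rewrite bE; apply: measurable_fun_restrict_borel.
      exact: measurableC.
    by have [] := NP i.
  rewrite /b; case: ifPn => [|_]; last by rewrite enorm0.
  by rewrite inE => -[sD _]; exact: a1.
exists b => // z; apply/funext => t; congr (_ + _); apply/rowP => i; rewrite !mxE.
congr fine; rewrite (_ : [set s | 0 <= s <= t] = `[0, t]%classic); last first.
  by apply/seteqP; split => s /=; rewrite in_itv.
have mb : measurable_fun [set: R] (fun s => (b s 0 i)%:E).
  by apply/measurable_EFinP; exact: (bb.1 i).
rewrite -integral_lebesgueR//.
have mt : measurable (`[0, t]%classic : set (lebesgueR R)).
  by apply: sub_caratheodory; exact: measurable_itv.
apply: (@ae_eq_integral _ (lebesgueR R) R (lebesgue R) `[0, t]%classic).
- exact: mt.
- apply/measurable_EFinP; apply: measurable_funS (ma i) => //.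
  by move=> s /=; rewrite in_itv => /andP[].
- apply: (@measurable_funTS _ _ (lebesgueR R) _ _ (fun s => (b s 0 i)%:E)).
  move=> _ Y mY; rewrite setTI; apply: sub_caratheodory.
  by rewrite -[X in measurable X]setTI; exact: mb.
- have [N1 [mN1 N10 NN1]] := NN0.
  exists N1; split => //; first exact: sub_caratheodory.
  move=> s /= h; apply: NN1; apply: contrapT => NNs; apply: h => /=.
  rewrite in_itv => /= /andP[s0 _]; rewrite /b ifT//.
  by rewrite inE.
Qed.

End curves.

Section displacement.
Context {R : realType} {n : nat}.
Notation mu := (@lebesgue_measure R).
Implicit Types (b : R -> 'rV[R]_n) (z w : 'rV[R]_n).

Lemma displacement_split b u s t : borel_control b -> s <= u <= t ->
  displacement b s t = displacement b s u + displacement b u t.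
Proof.
move=> bb sut; apply/rowP => i; rewrite !mxE.
by rewrite (Rintegral_itv_split (borel_control_coord i bb) sut).
Qed.

Lemma displacement_le0 b t : t <= 0 -> displacement b 0 t = 0.
Proof.
move=> t0; apply/rowP => i; rewrite !mxE.
move: t0; rewrite le_eqVlt => /predU1P[->|t0].
  by rewrite set_itv1 Rintegral_set1.
by rewrite set_itv_ge ?Rintegral_set0// bnd_simp -ltNge.
Qed.

Lemma displacement_translate b c s t : borel_control b ->
  displacement (fun r => b (r + c)) s t = displacement b (s + c) (t + c).
Proof.
move=> bb; apply/rowP => i; rewrite !mxE.
by rewrite (Rintegral_translate c s t (borel_control_coord i bb)).
Qed.

(* Testing against the displacement itself reduces the vector-valued estimate
   to a scalar one. *)
Lemma enorm_displacement b s t : borel_control b -> s <= t ->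
  enorm (displacement b s t) <= t - s.
Proof.
move=> bb st; set w := displacement b s t.
have [bs Is] := bounded_measurable_sum (index_enum 'I_n) (fun i => w 0 i)
  (fun i => borel_control_coord i bb).
have : dot w w <= enorm w * (t - s).
  rewrite [leLHS](_ : _ = \int[mu]_(r in `[s, t]) dot w (b r)).
    apply: Rintegral_itv_ub => // r _; rewrite (le_trans (le_dot_enorm _ _))//.
    by rewrite ler_piMr// bb.2.
  by rewrite /dot Is; apply: eq_bigr => i _; rewrite [in X in _ * X]mxE.
rewrite -enorm_sqr; have := enorm_ge0 w.
rewrite le_eqVlt => /predU1P[<-|w0]; first by rewrite subr_ge0.
by rewrite expr2 ler_pM2l.
Qed.

End displacement.

(** * Trajectories: Lipschitz bound, shift, concatenation, differentiability *)

Section curve.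
Context {R : realType} {n : nat}.
Notation mu := (@lebesgue_measure R).
Implicit Types (b : R -> 'rV[R]_n) (z w q : 'rV[R]_n) (y : R -> 'rV[R]_n).

Definition curve z y := exists2 a, admissible a & y = trajectory z a.

Lemma curveP z y : curve z y <->
  exists2 b, borel_control b & y = fun t => z + displacement b 0 t.
Proof.
split=> [[a aa ->]|[b bb ->]].
  by have [b bb ab] := admissible_borel_control aa; exists b.
by have [ab <-] := borel_control_admissible z bb; exists b.
Qed.

Lemma curve_start z y : curve z y -> y 0 = z.
Proof. by move=> /curveP[b bb ->]; rewrite displacement_le0// addr0. Qed.

Lemma curve_dist z y s t : curve z y -> enorm (y t - y s) <= `|t - s|.
Proof.
move=> /curveP[b bb ->]; wlog st : s t / s <= t => [H|].
  have [|/ltW] := leP s t; first exact: H.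
  by rewrite enormC distrC; exact: H.
rewrite opprD addrACA subrr add0r (ger0_norm (_ : 0 <= t - s)) ?subr_ge0//.
have [t0|t0] := leP t 0.
  by rewrite !displacement_le0// ?subrr ?enorm0 ?subr_ge0// (le_trans st).
have [s0|s0] := leP s 0.
  rewrite (displacement_le0 _ s0) subr0.
  by rewrite (le_trans (enorm_displacement bb (ltW t0)))// lerB.
rewrite (displacement_split bb (_ : 0 <= s <= t)) ?(ltW s0)// addrAC subrr add0r.
exact: enorm_displacement.
Qed.

Lemma curve_continuous z y : curve z y -> continuous y.
Proof.
move=> cy t; apply/cvgrPdist_le => e e0; near=> s.
rewrite (le_trans (norm_le_enorm _))// (le_trans (curve_dist _ _ cy))//.
Unshelve. all: by end_near. Qed.

Lemma curve_shift z y s : curve z y -> 0 <= s ->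
  exists2 y', curve (y s) y' & forall u, 0 <= u -> y' u = y (s + u).
Proof.
move=> /curveP[b bb ->] s0.
have bb' : borel_control (fun r => b (r + s)).
  split=> [i|r]; last exact: bb.2.
  apply: (measurableT_comp (bb.1 i)).
  by apply: measurable_funD; [exact: measurable_id|exact: measurable_cst].
exists (fun t => z + displacement b 0 s + displacement (fun r => b (r + s)) 0 t).
  by apply/curveP; exists (fun r => b (r + s)).
move=> u u0; rewrite displacement_translate// add0r -addrA; congr (_ + _).
by rewrite -displacement_split// ?s0 ?lerDr// addrC.
Qed.

Lemma curve_concat z y s y' : curve z y -> 0 <= s -> curve (y s) y' ->
  exists y'', [/\ curve z y'', forall u, 0 <= u <= s -> y'' u = y u &
    forall u, 0 <= u -> y'' (s + u) = y' u].
Proof.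
move=> /curveP[b bb ->] s0 /curveP[b' bb' ->].
pose c r := if r <= s then b r else b' (r - s).
have bc : borel_control c.
  split=> [i|r]; last by rewrite /c; case: ifP => _; [exact: bb.2|exact: bb'.2].
  rewrite (_ : (fun r => _) = (fun r => b r 0 i) \_ `]-oo, s] \+
      (fun r => b' (r - s) 0 i) \_ `]s, +oo[); last first.
    apply/funext => r /=; rewrite !patchE !mem_setE !in_itv/= andbT /c ltNge.
    by case: ifP => _; rewrite ?addr0 ?add0r.
  apply: measurable_funD; apply: measurable_fun_restrict_borel => //.
    exact: bb.1.
  apply: (measurableT_comp (bb'.1 i)).
  by apply: measurable_funB; [exact: measurable_id|exact: measurable_cst].
have cb u : u <= s -> displacement c 0 u = displacement b 0 u.
  move=> us; apply/rowP => i; rewrite !mxE; apply: eq_Rintegral => r.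
  rewrite inE/= in_itv/= => /andP[_ ru]; rewrite /c ifT//.
  exact: le_trans us.
exists (fun t => z + displacement c 0 t); split.
- by apply/curveP; exists c.
- by move=> u /andP[_ us]; rewrite cb.
move=> u u0; rewrite (displacement_split bc (_ : 0 <= s <= s + u)) ?s0 ?lerDl//.
rewrite cb// addrA; congr (_ + _); apply/rowP => i; rewrite !mxE.
(* The left endpoint is dropped because [c] still equals [b] at time [s]; a single point does not
   affect the integral. *)
rewrite -(@Rintegral_itv_obnd_cbnd _ s); last first.
  apply: integrableS (bounded_measurable_integrable s (s + u)
    (borel_control_coord i bc)) => //.
  exact: subset_itv_oc_cc.
rewrite -(@Rintegral_itv_obnd_cbnd _ 0); last first.
  apply: integrableS (bounded_measurable_integrable 0 u
    (borel_control_coord i bb')) => //.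
  exact: subset_itv_oc_cc.
have bi : bounded_measurable (fun r => b' (r - s) 0 i).
  split; last by exists 1 => r; rewrite (le_trans (le_coord_enorm _ _))// bb'.2.
  apply: (measurableT_comp (bb'.1 i)).
  by apply: measurable_funB; [exact: measurable_id|exact: measurable_cst].
transitivity (\int[mu]_(r in `]s, s + u]) b' (r - s) 0 i).
  apply: eq_Rintegral => r; rewrite inE/= in_itv/= => /andP[sr _].
  by rewrite /c ifF// leNgt sr.
rewrite [LHS]Rintegral_itv_obnd_cbnd; last first.
  apply: integrableS (bounded_measurable_integrable s (s + u) bi) => //.
  exact: subset_itv_oc_cc.
rewrite [RHS]Rintegral_itv_obnd_cbnd; last first.
  apply: integrableS (bounded_measurable_integrable 0 u
    (borel_control_coord i bb')) => //.
  exact: subset_itv_oc_cc.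
have := Rintegral_translate s 0 u bi; rewrite add0r (addrC u) => ->.
by apply: eq_Rintegral => r _; rewrite addrK.
Qed.

Lemma curve_line z q : enorm q <= 1 ->
  exists2 y, curve z y & forall u, 0 <= u -> y u = z + u *: q.
Proof.
move=> q1; exists (fun t => z + displacement (cst q) 0 t).
  by apply/curveP; exists (cst q) => //; split => // i; exact: measurable_cst.
move=> u u0; congr (_ + _); apply/rowP => i; rewrite !mxE.
by rewrite Rintegral_itv_cst// subr0 mulrC.
Qed.

(** Lebesgue differentiation ([FTC1]) applies to each coordinate of a Borel control, and the
    finitely many exceptional null sets are united. *)
Lemma curve_derivable z y : curve z y ->
  {ae mu, forall s, 0 < s -> derivable y s 1}.
Proof.
move=> /curveP[b bb ->].
pose F i (t : R) := \int[mu]_(r in [set` Interval (BLeft 0) (BRight t)]) b r 0 i.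
have H (i : 'I_n) : {ae mu, forall s : R, 0 < s -> derivable (F i) s 1}.
  have bi := borel_control_coord i bb.
  have locb : locally_integrable [set: R] (fun r => b r 0 i).
    split; [exact: bi.1|exact: openT|move=> K _ cK].
    have /integrableP[] // : mu.-integrable K (EFin \o (fun r => b r 0 i)).
    apply: measurable_bounded_integrable => //.
    - exact: compact_measurable.
    - exact: compact_finite_measure.
    - exact: (measurable_funTS bi.1).
    - exists 1; split; first exact: num_real.
      move=> N N1 x _ /=; rewrite (le_trans (le_coord_enorm _ _))//.
      by rewrite (le_trans (bb.2 _))// ltW.
  have := @FTC1 R (fun r => b r 0 i) (BLeft 0) _ locb.
  move=> /(_ (fun t => bounded_measurable_integrable 0 t bi)).
  apply: filterS; first exact: (ae_filter_ringOfSetsType mu).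
  by move=> s Hs s0; case: Hs.
have fmu := ae_filter_ringOfSetsType mu.
apply: (@filterS _ _ fmu _ _ _ (filter_forall fmu H)) => s Hs s0.
apply: derivableD; first exact: derivable_cst.
apply/derivable_mxP => j i.
rewrite (_ : (fun t => _) = F i); first exact: Hs.
by apply/funext => t; rewrite mxE.
Qed.

End curve.

(** * Subgradients and one-sided derivatives *)

Section first_order.
Context {R : realType} {n : nat}.
Implicit Types (x z p : 'rV[R]_n) (u : 'rV[R]_n -> R).

(** The sup norm and the Euclidean norm are equivalent, with constants 1 and [Num.sqrt n%:R]; adding
    1 to the latter keeps the divisor positive when [n = 0]. *)
Lemma enorm_nbhs z (P : set 'rV[R]_n) : nbhs z P <->
  exists2 d, 0 < d & forall x, enorm (x - z) < d -> P x.
Proof.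
split=> [/nbhs_ballP[d /= d0 dP]|[d d0 dP]].
  exists d => // x xd; apply: dP; rewrite -ball_normE /ball_/= distrC.
  exact: le_lt_trans (norm_le_enorm _) xd.
have c0 : 0 < Num.sqrt n%:R + 1 :> R by rewrite ltr_wpDl ?sqrtr_ge0.
apply/nbhs_ballP; exists (d / (Num.sqrt n%:R + 1)) => /=; first exact: divr_gt0.
move=> x; rewrite -ball_normE /ball_/= distrC ltr_pdivlMr// => xd; apply: dP.
apply: le_lt_trans (enorm_le_norm _) _; apply: le_lt_trans xd.
by rewrite mulrC ler_wpM2l// lerDl.
Qed.

(** Clearing the denominator makes the inequality trivial at [x = z], so the punctured neighbourhood
    of the lower limit becomes a full ball. *)
Lemma subdiffP u z p : subdiff u z p <->
  forall e, 0 < e -> exists2 d, 0 < d & forall x, enorm (x - z) < d ->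
    dot p (x - z) - e * enorm (x - z) <= u x - u z.
Proof.
rewrite /subdiff /= limf_einfE.
set f := fun x => _%:E.
split=> [f0 e e0|fP].
  have : ((- e)%:E < ereal_sup [set ereal_inf (f @` A) | A in z^'])%E.
    by rewrite (lt_le_trans _ f0)// lte_fin oppr_lt0.
  move=> /ereal_sup_gt[_ [A zA <-] eA].
  have [d d0 dA] := (enorm_nbhs _ _).1 zA.
  exists d => // x xd; have [->|xz] := eqVneq x z.
    by rewrite !subrr enorm0 mulr0 subr0 dotr0.
  have Ax : A x by apply: dA.
  have : ((- e)%:E <= f x)%E.
    by rewrite ltW// (lt_le_trans eA)// ereal_inf_lbound//; exists x.
  by rewrite lee_fin ler_pdivlMr ?enorm_gt0 ?subr_eq0//; lra.
apply/lee_addgt0Pr => e e0; have [d d0 dP] := fP e e0.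
apply: (@le_trans _ _ ((- e)%:E + e%:E)%E); first by rewrite -EFinD addNr.
apply: leeD2r.
apply: le_ereal_sup_tmp; exists (ereal_inf (f @` [set x | x != z /\ enorm (x - z) < d])).
  exists [set x | x != z /\ enorm (x - z) < d] => //.
  by apply/enorm_nbhs; exists d.
apply: le_ereal_inf_tmp => _ [x [xz xd] <-].
rewrite lee_fin ler_pdivlMr ?enorm_gt0 ?subr_eq0//.
by have := dP x xd; lra.
Qed.

Lemma derivable_expansion (y : R -> 'rV[R]_n) s : derivable y s 1 ->
  forall e, 0 < e -> exists2 d, 0 < d & forall r, `|r - s| < d ->
    enorm (y r - y s - (r - s) *: (y^`() s)%classic) <= e * `|r - s|.
Proof.
move=> ys e e0.
have : (fun h => h^-1 *: (y (h *: 1 + s) - y s)) h @[h --> 0^'] --> (y^`() s)%classic.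
  by rewrite derive1E; exact: ys.
move=> /(_ [set w | enorm (w - (y^`() s)%classic) < e]).
have /[swap]/[apply] : nbhs (y^`() s)%classic
    [set w | enorm (w - (y^`() s)%classic) < e].
  by apply/enorm_nbhs; exists e.
move=> /nbhs_ballP[d /= d0 dP]; exists d => // r rd.
have [->|rs] := eqVneq r s.
  by rewrite !subrr scale0r subr0 enorm0 normr0 mulr0.
have := dP (r - s); rewrite /ball/= sub0r normrN subr_eq0 => /(_ rd rs).
rewrite /GRing.scale/= mulr1 subrK => yrs.
rewrite (_ : y r - y s - _ =
    (r - s) *: ((r - s)^-1 *: (y r - y s) - (y^`() s)%classic)).
  by rewrite enormZ mulrC ler_wpM2r// ltW.
by rewrite scalerBr scalerA mulfV ?subr_eq0// scale1r.
Qed.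

End first_order.

(** * Monotonicity from left difference quotients *)

Section left_derivative.
Context {R : realType}.
Notation mu := (@lebesgue_measure R).

Lemma negligible_open_cover (N : set R) (e : R) : mu.-negligible N -> 0 < e ->
  exists U : set R, [/\ open U, N `<=` U & (mu U <= e%:E)%E].
Proof.
move=> /negligible_outer_measure N0 e0.
have [U [oU NU Ue]] := outer_measure_open_le N e0.
by exists U; split => //; move: Ue; rewrite N0 add0e.
Qed.

(* The exceptional set is charged to a function [phi] that increases at unit
   speed on an open neighbourhood of it and whose total increase is small. *)
Lemma le_of_left_derivative (g : R -> R) (N : set R) (K t : R) :
  0 <= K -> 0 <= t -> mu.-negligible N ->
  (forall r s, 0 <= r -> r <= s -> s <= t -> g s - g r <= K * (s - r)) ->
  (forall s, 0 < s -> s <= t -> ~ N s -> forall e, 0 < e ->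
    exists2 d, 0 < d & forall r, 0 <= r -> s - d < r -> r < s ->
      g s - g r <= e * (s - r)) ->
  g t <= g 0.
Proof.
move=> K0 t0 N0 gK gN; apply/ler_addgt0Pr => e' e'0.
(* The final error is at most [e * t + K * e]: the slope [e] accumulated over [[0, t]], plus [K]
   times the total increase of [phi]. *)
pose e := e' / (t + K + 1).
have e0 : 0 < e by rewrite divr_gt0// ltr_wpDl// addr_ge0.
have [U [oU NU Ue]] := negligible_open_cover N0 e0.
have mU : measurable U by exact: open_measurable.
pose phi (s : R) : R := fine (mu (U `&` `[0, s])).
have mUs s : measurable (U `&` `[0, s]).
  by apply: measurableI => //; exact: measurable_itv.
have le_mu (A B : set R) : measurable A -> measurable B -> A `<=` B ->
    (mu A <= mu B)%E.
  by move=> mA mB AB; apply: le_measure; rewrite ?inE.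
have phi_fin s : mu (U `&` `[0, s]) \is a fin_num.
  rewrite ge0_fin_numE//; apply: le_lt_trans (ltry e); apply: le_trans Ue.
  by apply: le_mu => //; exact: subIsetl.
have phiE s : mu (U `&` `[0, s]) = (phi s)%:E by rewrite fineK.
have phi_ge0 s : 0 <= phi s by rewrite fine_ge0.
have phi_le s : phi s <= e.
  rewrite -lee_fin -phiE; apply: le_trans Ue.
  by apply: le_mu => //; exact: subIsetl.
have phi_nd r s : r <= s -> phi r <= phi s.
  move=> rs; rewrite -lee_fin -!phiE; apply: le_mu => //.
  apply: setIS => x /=; rewrite !in_itv/= => /andP[-> /le_trans]; exact.
have phi_incr r s : 0 <= r -> r <= s -> `]r, s] `<=` U ->
    phi r + (s - r) <= phi s.
  move=> r0 rs rsU; rewrite -lee_fin EFinD -!phiE.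
  have -> : ((s - r)%:E = mu `]r, s])%E.
    rewrite lebesgue_measure_itv/= lte_fin -EFinB.
    move: rs; rewrite le_eqVlt => /predU1P[->|->//].
    by rewrite ltxx subrr.
  apply: (@le_trans _ _ (mu ((U `&` `[0, r]) `|` `]r, s]))).
    rewrite measureU; [by []|exact: mUs|exact: measurable_itv|].
    apply/seteqP; split => x //= [[_]].
    by rewrite !in_itv/= => /andP[_ xr] /andP[]; rewrite ltNge xr.
  apply: le_mu => //; first by apply: measurableU => //; exact: measurable_itv.
  move=> x [[Ux]|rx] /=.
    rewrite !in_itv/= => /andP[x0 xr]; split => //.
    by rewrite x0 (le_trans xr).
  split; first exact: rsU.
  by move: rx; rewrite /= !in_itv/= => /andP[/ltW/(le_trans r0) -> ->].
(* The aim is [F t <= F 0]. The infimum [tau] of the times where [F] is at least [F t] must be 0,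
   since from a positive [tau] one can step left without decreasing [F]. *)
pose F s := g s - e * s - K * phi s.
pose S := [set s | 0 <= s <= t /\ F t <= F s].
have St : S t by split => //; rewrite t0 lexx.
have Slb : has_inf S.
  by split; [exists t|exists 0 => s [/andP[]]].
set tau := inf S.
have tau0 : 0 <= tau by apply: lb_le_inf; [exists t|move=> s [/andP[]]].
have taut : tau <= t by apply: ge_inf => //; exact: Slb.2.
(* The infimum is attained although [S] is not known to be closed: [F] rises at rate at most [K], so
   values just to the right of [tau] bound [F tau] from below. *)
have Stau : S tau.
  split; first by rewrite tau0 taut.
  apply/ler_addgt0Pr => c c0.
  have d0 : 0 < c / (K + 1) by rewrite divr_gt0// ltr_wpDl.
  have [s [/andP[s0 st] Fs] std] := inf_adherent d0 Slb.
  have taus : tau <= s by apply: ge_inf; [exact: Slb.2|split => //; rewrite s0].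
  apply: le_trans Fs _; rewrite -lerBlDl /F.
  have h1 := gK _ _ tau0 taus st.
  have h2 : 0 <= K * (phi s - phi tau) by rewrite mulr_ge0// subr_ge0 phi_nd.
  have h3 : 0 <= e * (s - tau) by rewrite mulr_ge0 ?(ltW e0)// subr_ge0.
  have h4 : K * (s - tau) <= c.
    have : (K + 1) * (s - tau) <= c.
      by rewrite mulrC -ler_pdivlMr ?ltr_wpDl// lerBlDl ltW.
    by apply: le_trans; rewrite ler_wpM2r ?subr_ge0// lerDl.
  lra.
have [tau_gt0|] := ltP 0 tau; last first.
  move=> tau_le0; have tauE : tau = 0 by apply/le_anti; rewrite tau0 tau_le0.
  move: Stau => [_]; rewrite tauE /F.
  have h1 : K * phi t <= K * e by rewrite ler_wpM2l.
  have h2 : 0 <= K * phi 0 by rewrite mulr_ge0.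
  have h3 : (t + K + 1) * e = e'.
    by rewrite /e mulrC divfK// gt_eqF// ltr_wpDl// addr_ge0.
  lra.
have smaller r : 0 <= r -> r < tau -> F tau <= F r -> False.
  move=> r0 rtau Fr; have : tau <= r.
    apply: ge_inf; first exact: Slb.2.
    split; first by rewrite r0 (le_trans (ltW rtau)).
    exact: le_trans Stau.2 Fr.
  by rewrite leNgt rtau.
exfalso.
(* Off [N], the left difference quotient is at most [e], the slope subtracted in [F]. On [N], an
   interval to the left of [tau] lies in [U], where [K * phi] grows at rate [K] and absorbs the
   growth of [g]. *)
have [Ntau|Ntau] := pselect (N tau); last first.
  have [d d0 gd] := gN _ tau_gt0 taut Ntau _ e0.
  pose r := tau - Num.min d tau / 2.
  have m0 : 0 < Num.min d tau by rewrite lt_min d0.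
  have md : Num.min d tau <= d by rewrite ge_min lexx.
  have mt : Num.min d tau <= tau by rewrite ge_min lexx orbT.
  have r0 : 0 <= r by rewrite /r; lra.
  have rtau : r < tau by rewrite /r; lra.
  have rd : tau - d < r by rewrite /r; lra.
  apply: (smaller r) => //; rewrite /F.
  have := gd r r0 rd rtau.
  have : 0 <= K * (phi tau - phi r) by rewrite mulr_ge0// subr_ge0 phi_nd// ltW.
  lra.
have /nbhs_ballP[d /= d0 dU] : nbhs tau U.
  by apply: open_nbhs_nbhs; split => //; exact: NU.
pose r := tau - Num.min d tau / 2.
have m0 : 0 < Num.min d tau by rewrite lt_min d0.
have md : Num.min d tau <= d by rewrite ge_min lexx.
have mt : Num.min d tau <= tau by rewrite ge_min lexx orbT.
have r0 : 0 <= r by rewrite /r; lra.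
have rtau : r < tau by rewrite /r; lra.
have rd : tau - d < r by rewrite /r; lra.
apply: (smaller r) => //; rewrite /F.
have h1 := gK _ _ r0 (ltW rtau) taut.
have rU : `]r, tau] `<=` U.
  move=> x /=; rewrite in_itv/= => /andP[rx xtau]; apply: dU.
  by rewrite /ball/= ger0_norm ?subr_ge0// ltrBlDr -ltrBlDl (lt_trans rd).
have h2 : K * (tau - r) <= K * (phi tau - phi r).
  by rewrite ler_wpM2l// lerBrDl phi_incr// ltW.
have h3 : 0 <= e * (tau - r) by rewrite mulr_ge0 ?(ltW e0)// subr_ge0 ltW.
lra.
Qed.

End left_derivative.

(** * Estimates for the length of a perturbed vector *)

Section perturbation.
Context {R : realType}.

Lemma exists_lt_both (a b : R) : 0 < a -> 0 < b ->
  exists t, [/\ 0 < t, t < a & t < b].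
Proof.
move=> a0 b0; have m0 : 0 < Num.min a b by rewrite lt_min a0.
exists (Num.min a b / 2).
have : Num.min a b / 2 < Num.min a b by rewrite ltr_pdivrMr// ltr_pMr// ltr1n.
by rewrite lt_min => /andP[? ?]; split => //; exact: divr_gt0.
Qed.

(** With [c = dot q u] and [m] the quadratic term, the square of [k + c + m] exceeds that of the
    left side by exactly [(c + m) ^+ 2]; the bound on [u] makes [k + c + m] nonnegative. *)
Lemma enorm_perturbation n (q u : 'rV[R]_n) (k : R) : enorm q = 1 -> 0 < k ->
  enorm u <= k -> enorm (u + k *: q) <= k + dot q u + enorm u ^+ 2 / (2 * k).
Proof.
move=> q1 k0 uk.
have : - enorm u <= dot q u.
  by rewrite lerNl -dotNl (le_trans (le_dot_enorm _ _))// enormN q1 mul1r.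
have -> : enorm (u + k *: q) = Num.sqrt (enorm u ^+ 2 + 2 * k * dot q u + k ^+ 2).
  congr Num.sqrt; rewrite dotDl !dotDr !dotZl !dotZr -!enorm_sqr q1 (dotC u q); lra.
set c := dot q u; set m := enorm u ^+ 2 / (2 * k).
have mE : enorm u ^+ 2 = 2 * k * m by rewrite mulrC divfK// mulf_neq0// gt_eqF.
have m0 : 0 <= m by rewrite divr_ge0 ?sqr_ge0// mulr_ge0// ltW.
rewrite mE => cu; have s0 : 0 <= k + c + m by lra.
rewrite -[leRHS](ger0_norm s0) -sqrtr_sqr ler_wsqrtr//.
by have := sqr_ge0 (c + m); lra.
Qed.

(** Bookkeeping for [optimal_subgradient]: [d] is the distance from [w] to [y s], [k] is [s - r],
    [N] is the distance from [w] to [y r], and [D] is the increment of [v]. The terms [L * k]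
    cancel; the errors carrying [e] and the quadratic error [m] each cost half of [eta * d]. *)
Lemma subgradient_estimate (L eta A e d c m k N D : R) : 0 <= L -> 0 <= d ->
  0 < e -> e <= 1 -> 0 <= A -> e * (2 * A + 1 + (L + 1) * A) <= eta / 2 ->
  0 <= m -> (L + 1) * m <= eta / 2 * d -> k = A * d ->
  `|c| <= d -> N <= k + c + m + e * k ->
  (L - e) * k - (L + e) * N <= D -> - (L * c) - eta * d <= D.
Proof.
move=> L0 d0 e0 e1 A0 eA m0 Lm kE cd NE.
have k0 : 0 <= k by rewrite kE mulr_ge0.
apply: le_trans.
have h1 : (L + e) * N <= (L + e) * (k + c + m + e * k).
  by rewrite ler_wpM2l// addr_ge0// ltW.
have h2 : (L + e) * (m + e * k) <= (L + 1) * (m + e * k).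
  by rewrite ler_wpM2r ?lerD2l// addr_ge0// mulr_ge0// ltW.
have h3 : e * c <= e * d by rewrite ler_wpM2l ?(ltW e0)// (le_trans (ler_norm _)).
have h4 : e * (2 * A + 1 + (L + 1) * A) * d <= eta / 2 * d by rewrite ler_wpM2r.
move: h1 h2 h3 h4; rewrite kE; lra.
Qed.

End perturbation.

(** * Running cost, value function and optimal curves *)

Section running_cost.
Context {R : realType} {n : nat} (M : set 'rV[R]_n) (l : 'rV[R]_n -> R).
Hypotheses (M0 : M !=set0) (Mclosed : closed M) (lcont : continuous l)
  (lbounded : exists C : R, forall z, `|l z| <= C)
  (lpos : forall z, ~ M z -> 0 < l z) (lzero : forall z, M z -> l z = 0).
Notation mu := (@lebesgue_measure R).
Implicit Types (z : 'rV[R]_n) (y : R -> 'rV[R]_n).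

Definition avoids y t := forall r, 0 <= r <= t -> ~ M (y r).

Definition running_cost y t := \int[mu]_(r in `[0, t]) l (y r).

Definition first_hit y : \bar R :=
  ereal_inf [set s%:E | s in [set s : R | 0 <= s /\ M (y s)]].

Lemma running_ge0 z : 0 <= l z.
Proof.
by have [/lzero ->//|/lpos/ltW] := pselect (M z).
Qed.

Lemma running_bounded_measurable y : continuous y ->
  bounded_measurable (l \o y).
Proof.
move=> cy; split; last by have [C lC] := lbounded; exists C => r; exact: lC.
apply: continuous_measurable_fun => r.
by apply: continuous_comp; [exact: cy|exact: lcont].
Qed.

(** Since [M] is closed, a continuous curve avoiding it on [[0, t]] avoids it a little longer,
    whence the strict inequality. For [t < 0] both sides hold. *)
Lemma lt_hitting_time y t : continuous y ->
  (t%:E < first_hit y)%E <->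
  avoids y t.
Proof.
move=> cy; split=> [th r /andP[r0 rt] Mr|yt].
  have := @ereal_inf_lbound _ [set s%:E | s in [set s : R | 0 <= s /\ M (y s)]]
    r%:E (ex_intro2 _ _ r (conj r0 Mr) erefl).
  by move=> /(lt_le_trans th); rewrite lte_fin ltNge rt.
have oM : open (~` (y @^-1` M)).
  by rewrite openC; apply: preimage_closed => // s _; exact: cy.
have [t0|t0] := ltP t 0.
  apply: (@lt_le_trans _ _ 0%E); first by rewrite lte_fin.
  by apply: le_ereal_inf_tmp => _ [s [s0 _] <-]; rewrite lee_fin.
have /nbhs_ballP[e /= e0 te] : nbhs t (~` (y @^-1` M)).
  by apply: open_nbhs_nbhs; split => //; apply: yt; rewrite t0 lexx.
apply: (@lt_le_trans _ _ (t + e)%:E); first by rewrite lte_fin ltrDl.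
apply: le_ereal_inf_tmp => _ [s [s0 Ms] <-]; rewrite lee_fin leNgt.
apply/negP => ste; have [st|ts] := leP s t; first by apply: (yt s) => //; rewrite s0.
by apply: (te s) => //; rewrite /ball/= ler0_norm ?subr_le0 ?(ltW ts)// opprB ltrBlDl.
Qed.

Lemma running_costE y t : continuous y ->
  (\int[mu]_(r in `[0%R, t]) (l (y r))%:E)%E = (running_cost y t)%:E.
Proof.
move=> cy; rewrite fineK//; apply: integrable_fin_num => //.
exact: (bounded_measurable_integrable 0 t (running_bounded_measurable cy)).
Qed.

(** * The cost as a limit of running costs *)

Section cost.
Variable y : R -> 'rV[R]_n.
Hypothesis cy : continuous y.

Let h := first_hit y.
Let D := [set s : R | 0 <= s /\ (s%:E < h)%E].
(** Times increasing to the hitting time from strictly below, whether it is finite or infinite. They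
    may be negative for small [k]; the value at [-oo] is excluded by [h_ge0]. *)
Let tau (k : nat) : R :=
  match h with EFin r => r - k.+1%:R^-1 | EPInf => k%:R | ENInf => -1 end.

Let h_ge0 : (0 <= h)%E.
Proof. by apply: le_ereal_inf_tmp => _ [s [s0 _] <-]; rewrite lee_fin. Qed.

Let tau_lt k : ((tau k)%:E < h)%E.
Proof.
rewrite /tau; move: h_ge0; case: h => [r _|_|//].
- by rewrite lte_fin ltrBlDr ltrDl invr_gt0.
- by rewrite ltry.
Qed.

Let tau_nd : nondecreasing_seq tau.
Proof.
move=> i j ij; rewrite /tau; case: h => [r||//].
- by rewrite lerB// lef_pV2 ?posrE// ler_nat ltnS.
- by rewrite ler_nat.
Qed.

Let domainE : D = \bigcup_k `[0, tau k]%classic.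
Proof.
apply/seteqP; split=> s; last first.
  move=> [k _]; rewrite /= in_itv/= => /andP[s0 sk]; split => //.
  by rewrite (le_lt_trans _ (tau_lt k))// lee_fin.
move=> [s0 sh]; suff [k sk] : exists k, s <= tau k.
  by exists k => //; rewrite /= in_itv/= s0.
move: sh; rewrite /tau; case: h => [r||//].
- rewrite lte_fin -subr_gt0 => sr.
  near \oo => k; exists k; rewrite lerBrDr -lerBrDl ltW//.
  by near: k; exact: near_infty_natSinv_lt (PosNum sr).
- move=> _; near \oo => k; exists k.
  by near: k; exact: nbhs_infty_ger.
Unshelve. all: by end_near. Qed.

Let lyE : measurable_fun [set: R] (fun s => (l (y s))%:E).
Proof.
by apply/measurable_EFinP; exact: (running_bounded_measurable cy).1.
Qed.

Let measurable_domain : measurable D.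
Proof. by rewrite domainE; apply: bigcupT_measurable => k; exact: measurable_itv. Qed.

Lemma running_cost_le_cost t : avoids y t ->
  ((running_cost y t)%:E <= 
   \int[lebesgue R]_(s in [set s : R | (0 <= s)%R /\ s%:E < first_hit y])
     (l (y s))%:E)%E.
Proof.
move=> /(lt_hitting_time _ cy) th; rewrite -/D integral_lebesgueR// -running_costE//.
apply: ge0_subset_integral => //.
- exact: (measurable_funTS lyE).
- by move=> s _; rewrite lee_fin running_ge0.
- move=> s /=; rewrite in_itv/= => /andP[s0 st]; split => //.
  by rewrite (le_lt_trans _ th)// lee_fin.
Qed.

(** Monotone convergence along [tau]. The sign of [B] covers the indices where [tau k] is negative
    and the interval is empty. *)
Lemma cost_le B : 0 <= B ->
  (forall t, 0 <= t -> avoids y t -> running_cost y t <= B) ->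
  (
   \int[lebesgue R]_(s in [set s : R | (0 <= s)%R /\ s%:E < first_hit y])
     (l (y s))%:E <= B%:E)%E.
Proof.
move=> B0 yB; rewrite -/D integral_lebesgueR// domainE.
have cvgD : (\int[mu]_(s in `[0%R, tau k]) (l (y s))%:E)%E @[k --> \oo] -->
    (\int[mu]_(s in \bigcup_k `[0%R, tau k]%classic) (l (y s))%:E)%E.
  apply: ge0_nondecreasing_set_cvg_integral.
  - move=> i j ij; apply/subsetPset => s /=; rewrite !in_itv/= => /andP[-> si].
    by rewrite (le_trans si)// tau_nd.
  - by move=> k; exact: measurable_itv.
  - by move=> k; exact: (measurable_funTS lyE).
  - by move=> k s _; rewrite lee_fin running_ge0.
rewrite -(cvg_lim _ cvgD)//; apply: lime_le; first by apply/cvg_ex; eexists; exact: cvgD.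
apply: nearW => k; have [t0|t0] := ltP (tau k) 0.
  by rewrite set_itv_ge ?integral_set0 ?lee_fin// bnd_simp -ltNge.
rewrite running_costE// lee_fin yB//.
exact/(lt_hitting_time _ cy)/tau_lt.
Qed.

End cost.

(** * Finiteness of the value function and a criterion for optimality *)

Let v z := fine (value M l z).

Let costE z a : (cost M l z a = \int[lebesgue R]_(s in [set s : R | (0 <= s)%R /\
    s%:E < first_hit (trajectory z a)]) (l (trajectory z a s))%:E)%E.
Proof. by []. Qed.

Lemma cost_ge0 z a : (0 <= cost M l z a)%E.
Proof. by apply: integral_ge0 => s _; rewrite lee_fin running_ge0. Qed.

Lemma value_ge0 z : (0 <= value M l z)%E.
Proof. by apply: le_ereal_inf_tmp => _ [a _ <-]; exact: cost_ge0. Qed.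

Lemma fine_value_ge0 z : 0 <= v z.
Proof. by rewrite fine_ge0// value_ge0. Qed.

Lemma value_le_cost z a : admissible a -> (value M l z <= cost M l z a)%E.
Proof. by move=> aa; apply: ereal_inf_lbound; exists a. Qed.

Lemma running_cost_ub y t c : continuous y -> 0 <= t ->
  (forall r, 0 <= r <= t -> l (y r) <= c) -> running_cost y t <= c * t.
Proof.
move=> cy t0 lc; rewrite -[in leRHS](subr0 t).
exact: (Rintegral_itv_ub (running_bounded_measurable cy)).
Qed.

Lemma running_cost_lb y t c : continuous y -> 0 <= t ->
  (forall r, 0 <= r <= t -> c <= l (y r)) -> c * t <= running_cost y t.
Proof.
move=> cy t0 lc; rewrite -[in leLHS](subr0 t).
exact: (Rintegral_itv_lb (running_bounded_measurable cy)).
Qed.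

Lemma value_fin z : value M l z \is a fin_num.
Proof.
have [m Mm] := M0; have [C lC] := lbounded.
have C0 : 0 <= C by rewrite (le_trans _ (lC z)).
rewrite ge0_fin_numE ?value_ge0//.
(* The direction of the segment from [z] to [m]; if [m = z], the convention [0^-1 = 0] makes it 0,
   hence only a bound on its norm. *)
have [q q1 qm] : exists2 q, enorm q <= 1 & z + enorm (m - z) *: q = m.
  exists ((enorm (m - z))^-1 *: (m - z)).
    rewrite enormZ ger0_norm ?invr_ge0//.
    by have [->|mz0] := eqVneq (enorm (m - z)) 0; rewrite ?mulr0// mulVf.
  have [mz|mz] := eqVneq (m - z) 0; last first.
    by rewrite scalerA mulfV ?enorm_eq0// scale1r addrC subrK.
  by rewrite mz !scaler0 addr0; move/eqP: mz; rewrite subr_eq0 => /eqP.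
have [y cyz yE] := curve_line z q1; have cy := curve_continuous cyz.
case: cyz => a aa ya.
apply: le_lt_trans (value_le_cost z aa) _.
apply: (@le_lt_trans _ _ (C * enorm (m - z))%:E); last exact: ltry.
rewrite costE -ya; apply: cost_le => // [|t t0 yt]; first exact: mulr_ge0.
rewrite (le_trans (running_cost_ub (c := C) cy t0 _))//.
  by move=> r _; rewrite (le_trans (ler_norm _)).
rewrite ler_wpM2l// leNgt; apply/negP => /ltW zt.
by apply: (yt (enorm (m - z))); rewrite ?zt ?andbT// yE ?qm.
Qed.

Lemma valueE z : value M l z = (v z)%:E.
Proof. by rewrite fineK// value_fin. Qed.

Lemma value_le z y B : curve z y -> 0 <= B ->
  (forall t, 0 <= t -> avoids y t -> running_cost y t <= B) -> v z <= B.
Proof.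
move=> cyz B0 yB; have cy := curve_continuous cyz; case: cyz => a aa ya.
rewrite -lee_fin -valueE (le_trans (value_le_cost z aa))//.
by rewrite costE -ya; exact: cost_le.
Qed.

Lemma value_near_optimal z e : 0 < e -> exists2 y, curve z y &
  forall t, 0 <= t -> avoids y t -> running_cost y t <= v z + e.
Proof.
move=> e0; have [_ [a aa <-] ae] := lb_ereal_inf_adherent e0 (value_fin z).
have cya : curve z (trajectory z a) by exists a.
exists (trajectory z a) => // t t0 yt; rewrite -lee_fin EFinD -valueE.
apply: le_trans (ltW ae); rewrite costE.
exact: (running_cost_le_cost (curve_continuous cya) yt).
Qed.

(** Only the inequality cost at most value has content, and the cost is bounded exactly when all
    running costs before hitting are. *)
Lemma optimalP z a : admissible a -> optimal M l z a <->
  forall t, 0 <= t -> avoids (trajectory z a) t ->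
    running_cost (trajectory z a) t <= v z.
Proof.
move=> aa; have cya : curve z (trajectory z a) by exists a.
have cy := curve_continuous cya.
rewrite /optimal; split=> [oa t t0 yt|yv].
  by rewrite -lee_fin -valueE -oa costE; exact: (running_cost_le_cost cy yt).
apply/eqP; rewrite eq_le value_le_cost// andbT valueE.
by rewrite costE; apply: cost_le => //; exact: fine_value_ge0.
Qed.

(** * Dynamic programming *)

Lemma eq_running_cost y y' t : (forall r, 0 <= r <= t -> y r = y' r) ->
  running_cost y t = running_cost y' t.
Proof.
by move=> yy; apply: eq_Rintegral => r; rewrite inE/= in_itv/= => /yy ->.
Qed.

Lemma running_cost_shift y y' s t : continuous y -> 0 <= s -> 0 <= t ->
  (forall u, 0 <= u -> y' u = y (s + u)) ->
  running_cost y (s + t) = running_cost y s + running_cost y' t.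
Proof.
move=> cy s0 t0 yE; have bly := running_bounded_measurable cy.
rewrite /running_cost (Rintegral_itv_split bly (_ : 0 <= s <= s + t)); last first.
  by rewrite s0 lerDl.
congr (_ + _); have := Rintegral_translate s 0 t bly; rewrite add0r (addrC t) => ->.
by apply: eq_Rintegral => r; rewrite inE/= in_itv/= => /andP[r0 _]; rewrite yE// addrC.
Qed.

Lemma running_cost_ge0 y t : 0 <= running_cost y t.
Proof. by apply: Rintegral_ge0 => r _; exact: running_ge0. Qed.

Lemma running_cost_diff_le y r s c : continuous y -> 0 <= r -> r <= s ->
  (forall u, r <= u <= s -> l (y u) <= c) ->
  running_cost y s - running_cost y r <= c * (s - r).
Proof.
move=> cy r0 rs lc; have bly := running_bounded_measurable cy.
rewrite /running_cost (Rintegral_itv_split bly (_ : 0 <= r <= s)) ?r0//.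
by rewrite addrAC subrr add0r; exact: Rintegral_itv_ub.
Qed.

Lemma running_cost_diff_ge y r s c : continuous y -> 0 <= r -> r <= s ->
  (forall u, r <= u <= s -> c <= l (y u)) ->
  c * (s - r) <= running_cost y s - running_cost y r.
Proof.
move=> cy r0 rs lc; have bly := running_bounded_measurable cy.
rewrite /running_cost (Rintegral_itv_split bly (_ : 0 <= r <= s)) ?r0//.
by rewrite addrAC subrr add0r; exact: Rintegral_itv_lb.
Qed.

Lemma running_cost_start y : running_cost y 0 = 0.
Proof. by rewrite /running_cost set_itv1 Rintegral_set1. Qed.

(** The competitor follows [y] up to time [t], then an almost optimal curve from [y t]. If [y] meets
    [M] before [t], only the case [r <= t] occurs, where [l >= 0] suffices. *)
Lemma dynamic_programming_le z y t : curve z y -> 0 <= t ->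
  v z <= running_cost y t + v (y t).
Proof.
move=> cyz t0; have cy := curve_continuous cyz.
apply/ler_addgt0Pr => e e0.
have [y' cy' y'e] := value_near_optimal (y t) e0.
have [w [cw wy wy']] := curve_concat cyz t0 cy'.
have cw0 := curve_continuous cw.
have B0 : 0 <= running_cost y t + v (y t) + e.
  by rewrite !addr_ge0 ?running_cost_ge0 ?fine_value_ge0// ltW.
apply: (value_le cw B0) => r r0 wr.
have [rt|tr] := leP r t.
  have -> : running_cost w r = running_cost y r.
    by apply: eq_running_cost => u /andP[u0 ur]; rewrite wy// u0 (le_trans ur).
  have -> : running_cost y t =
      running_cost y r + running_cost (fun u => y (r + u)) (t - r).
    by rewrite -running_cost_shift// ?subr_ge0// subrKC.
  rewrite -!addrA lerDl !addr_ge0 ?running_cost_ge0 ?fine_value_ge0//.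
  exact: ltW.
have rt0 : 0 <= r - t by rewrite subr_ge0 ltW.
rewrite -(subrKC t r) (running_cost_shift cw0 t0 rt0 (y' := y')); last first.
  by move=> u u0; rewrite wy'.
rewrite (eq_running_cost (y' := y)); last by move=> u; exact: wy.
rewrite -addrA lerD2l y'e// => u /andP[u0 urt].
by rewrite -wy'//; apply: wr; rewrite addr_ge0//= -lerBrDl.
Qed.

(** The tail of [y] after time [s] competes for [v (y s)]. A general bound [B] lets this apply to
    both optimal and almost optimal curves. *)
Lemma dynamic_programming_ge z y s B : curve z y -> 0 <= s -> avoids y s ->
  (forall t, 0 <= t -> avoids y t -> running_cost y t <= B) ->
  running_cost y s + v (y s) <= B.
Proof.
move=> cyz s0 ys yB; have cy := curve_continuous cyz.
have [y' cy' y'E] := curve_shift cyz s0.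
rewrite -lerBrDl; apply: (value_le cy'); first by rewrite subr_ge0 yB.
move=> t t0 y't; rewrite lerBrDl -(running_cost_shift cy s0 t0 y'E).
apply: yB; first exact: addr_ge0.
move=> r /andP[r0 rst]; have [rs|sr] := leP r s; first by apply: ys; rewrite r0.
have := y't (r - s); rewrite y'E ?subr_ge0 ?(ltW sr)// subrKC; apply.
by rewrite /= lerBlDl.
Qed.

Lemma value_segment z w c :
  (forall x, enorm (x - z) <= enorm (w - z) -> l x <= c) ->
  v z <= c * enorm (w - z) + v w.
Proof.
move=> lc; have [->|wz0] := eqVneq w z.
  by rewrite subrr enorm0 mulr0 add0r.
have d0 : enorm (w - z) != 0 by rewrite enorm_eq0 subr_eq0.
pose q := (enorm (w - z))^-1 *: (w - z).
have q1 : enorm q = 1 by rewrite enormZ ger0_norm ?invr_ge0// mulVf.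
have zq : z + enorm (w - z) *: q = w by rewrite scalerA mulfV// scale1r subrKC.
have [|y cyz yE] := @curve_line _ _ z q; first by rewrite q1.
have cy := curve_continuous cyz.
have := dynamic_programming_le cyz (enorm_ge0 (w - z)).
rewrite (yE _ (enorm_ge0 (w - z))) zq. move=> /le_trans; apply.
rewrite lerD2r; apply: running_cost_ub => // r /andP[r0 rd]; apply: lc.
by rewrite yE// addrC addKr enormZ q1 mulr1 ger0_norm.
Qed.

Lemma value_lipschitz : exists2 C, 0 <= C &
  forall z w, v z - v w <= C * enorm (w - z).
Proof.
have [C lC] := lbounded; exists C; first by rewrite (le_trans _ (lC 0)).
move=> z w; rewrite lerBlDr; apply: value_segment => x _.
by rewrite (le_trans (ler_norm _)).
Qed.

Lemma running_near z e : 0 < e -> exists2 d, 0 < d &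
  forall x, enorm (x - z) < d -> l z - e <= l x <= l z + e.
Proof.
move=> e0; apply/enorm_nbhs.
have : nbhs (l z) [set c | l z - e <= c <= l z + e].
  apply/nbhs_ballP; exists e => // c; rewrite /ball/= ltr_distl => /andP[h1 h2].
  by apply/andP; split; lra.
exact: lcont.
Qed.

(* The viscosity supersolution property of the value function. *)
Lemma le_enorm_subdiff z p : subdiff v z p -> ~ M z -> l z <= enorm p.
Proof.
move=> /subdiffP pz Mz; rewrite leNgt; apply/negP => pl.
(* Three errors of size [e * t] occur below, from the variation of [l], from the subgradient
   inequality and from almost optimality; a gap of [4 * e] exceeds their sum. *)
have [e e0 eE] : exists2 e, 0 < e & l z = enorm p + 4 * e.
  exists ((l z - enorm p) / 4); first by rewrite divr_gt0// subr_gt0.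
  by rewrite mulrC divfK// subrKC.
have [d1 d10 d1P] := running_near z e0.
have [d2 d20 d2P] := pz e e0.
have [t [t0 td1 td2]] := exists_lt_both d10 d20.
have [y cyz yt] := value_near_optimal z (mulr_gt0 e0 t0).
have cy := curve_continuous cyz.
have yz r : 0 <= r -> r <= t -> enorm (y r - z) <= t.
  move=> r0 rt; rewrite -{1}(curve_start cyz).
  by rewrite (le_trans (curve_dist 0 r cyz))// subr0 ger0_norm.
have ly r : 0 <= r <= t -> l z - e <= l (y r).
  move=> /andP[r0 rt]; have /d1P/andP[] // : enorm (y r - z) < d1.
  exact: le_lt_trans (yz r r0 rt) td1.
have ay : avoids y t.
  move=> r rt /lzero lr; have := ly r rt; rewrite lr eE leNgt.
  by rewrite -addrA ltr_wpDl// subr_gt0 ltr_pMl// ltr1n.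
have h1 := dynamic_programming_ge cyz (ltW t0) ay yt.
have h2 := running_cost_lb cy (ltW t0) ly.
have tyz : enorm (y t - z) <= t by exact: yz (ltW t0) (lexx t).
have h3 := d2P _ (le_lt_trans tyz td2).
have h4 : - (enorm p * t) <= dot p (y t - z).
  rewrite lerNl -dotNl (le_trans (le_dot_enorm _ _))// enormN.
  by rewrite ler_wpM2l.
have h5 : e * enorm (y t - z) <= e * t by rewrite ler_pM2l.
have := mulr_gt0 e0 t0; move: h1 h2 h3 h4 h5; rewrite eE.
move: (running_cost y t) (v (y t)) (v z) (dot p _) (e * enorm _) => a b c d f.
move: (enorm p) => g; lra.
Qed.

(** * From descent directions to optimality *)

Lemma curve_dist_le z y r s : curve z y -> r <= s -> enorm (y r - y s) <= s - r.
Proof.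
move=> cyz rs; rewrite (le_trans (curve_dist _ _ cyz))// distrC ger0_norm//.
by rewrite subr_ge0.
Qed.

(** To first order, [v] drops along [y] by at least [enorm p * (s - r)] while the running cost grows
    by [l (y s) * (s - r)], and [l (y s) <= enorm p]. A subgradient bounds [v (y r)] from below,
    which controls the quotients for [r < s]. *)
Lemma descent_left_derivative z y s : curve z y -> 0 < s -> ~ M (y s) ->
  derivable y s 1 -> descent_directions v (y s) (y^`() s)%classic ->
  forall e, 0 < e -> exists2 d, 0 < d & forall r, 0 <= r -> s - d < r -> r < s ->
    (v (y s) + running_cost y s) - (v (y r) + running_cost y r) <= e * (s - r).
Proof.
move=> cyz s0 Ms dys [p [pv p0] py] e' e'0.
have cy := curve_continuous cyz.
have lp := le_enorm_subdiff pv Ms.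
have c0 : 0 < 2 + enorm p by rewrite ltr_wpDr.
(* The running cost and the subgradient inequality contribute an error [e] each, the expansion of
   [y] paired with [p] contributes [e * enorm p]. *)
pose e := e' / (2 + enorm p); have e0 : 0 < e by rewrite divr_gt0.
have ee' : e * (2 + enorm p) = e' by rewrite /e divfK// gt_eqF.
have [d1 d10 d1P] := running_near (y s) e0.
have [d2 d20 d2P] := (subdiffP _ _ _).1 pv e e0.
have [d3 d30 d3P] := derivable_expansion dys e0.
exists (Num.min d1 (Num.min d2 d3)); first by rewrite !lt_min d10 d20.
move=> r r0 sdr rs; have k0 : 0 < s - r by rewrite subr_gt0.
have : s - r < Num.min d1 (Num.min d2 d3) by lra.
rewrite !lt_min => /and3P[k1 k2 k3].
have h1 : running_cost y s - running_cost y r <= (l (y s) + e) * (s - r).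
  apply: running_cost_diff_le => // [|u /andP[ru us]]; first exact: ltW.
  have /d1P/andP[] // : enorm (y u - y s) < d1.
  by apply: le_lt_trans (curve_dist_le cyz us) _; lra.
have yrs := curve_dist_le cyz (ltW rs).
have h2 := d2P (y r) (le_lt_trans yrs k2).
have h3 : enorm (y r - y s - (r - s) *: (y^`() s)%classic) <= e * (s - r).
  have -> : s - r = `|r - s| by rewrite distrC gtr0_norm.
  by apply: d3P; rewrite distrC gtr0_norm.
have h4 : dot p (y r - y s) >= (s - r) * enorm p - enorm p * (e * (s - r)).
  rewrite -[in leRHS](subrK ((r - s) *: (y^`() s)%classic) (y r - y s)) dotDr.
  have dq : dot p (y^`() s)%classic = - enorm p.
    by rewrite -py dotZr -enorm_sqr expr2 mulrA mulNr mulVf ?enorm_eq0// mulN1r.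
  have -> : dot p ((r - s) *: (y^`() s)%classic) = (s - r) * enorm p.
    by rewrite dotZr dq mulrN -mulNr opprB.
  rewrite addrC lerD2r lerNl -dotNl (le_trans (le_dot_enorm _ _))// enormN.
  by rewrite ler_wpM2l.
have h5 : e * enorm (y r - y s) <= e * (s - r) by rewrite ler_pM2l.
have h6 : (l (y s) - enorm p) * (s - r) <= 0.
  by rewrite pmulr_lle0// subr_le0.
rewrite -ee'; move: h1 h2 h4 h5 h6.
move: (running_cost y s) (running_cost y r) (v (y s)) (v (y r)) => a b c f.
move: (e * enorm _) (dot p _) (l (y s)) => g h i.
move: (enorm p) => j; lra.
Qed.

Lemma optimal_of_descent z y : curve z y ->
  {ae mu, forall s, 0 < s -> avoids y s -> derivable y s 1 /\
    descent_directions v (y s) (y^`() s)%classic} ->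
  forall t, 0 <= t -> avoids y t -> running_cost y t <= v z.
Proof.
move=> cyz yN t t0 yt; have cy := curve_continuous cyz.
have [C C0 vC] := value_lipschitz.
have [K lK] := lbounded.
have K0 : 0 <= K by rewrite (le_trans _ (lK 0)).
pose g s := v (y s) + running_cost y s.
suff : g t <= g 0.
  have -> : g 0 = v z.
    by rewrite /g running_cost_start addr0 (curve_start cyz).
  by apply: le_trans; rewrite /g lerDr fine_value_ge0.
apply: (le_of_left_derivative (K := C + K) _ t0 yN); first exact: addr_ge0.
  move=> r s r0 rs st; rewrite /g.
  have h1 := vC (y s) (y r).
  have h2 : C * enorm (y r - y s) <= C * (s - r).
    by rewrite ler_wpM2l// (curve_dist_le cyz).
  have h3 : running_cost y s - running_cost y r <= K * (s - r).
    by apply: running_cost_diff_le => // u _; rewrite (le_trans (ler_norm _)).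
  move: h1 h2 h3; move: (running_cost y s) (running_cost y r) (C * enorm _).
  move: (v (y s)) (v (y r)) => a b c f h; lra.
move=> s s0 st /contrapT /(_ s0)[|dys ys].
  by move=> r /andP[r0 rs]; apply: yt; rewrite r0 (le_trans rs).
have Ms : ~ M (y s) by apply: yt; rewrite st ltW.
exact: (descent_left_derivative cyz s0 Ms dys ys).
Qed.

(** * From optimality to descent directions *)

Section optimal_descent.
Variables (z : 'rV[R]_n) (y : R -> 'rV[R]_n) (s : R).
Hypotheses (cyz : curve z y) (s0 : 0 < s) (ys : avoids y s)
  (dys : derivable y s 1)
  (yz : forall t, 0 <= t -> avoids y t -> running_cost y t <= v z).

Let q := (y^`() s)%classic.

Let Ms : ~ M (y s).
Proof. by apply: ys; rewrite lexx ltW. Qed.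

(* An optimal curve cannot be beaten by leaving it at time [r] along the
   segment to [w]. *)
Let segment_comparison e : 0 < e -> exists2 d, 0 < d & forall r w,
  0 <= r -> s - d < r -> r < s -> enorm (w - y s) < d ->
  (l (y s) - e) * (s - r) - (l (y s) + e) * enorm (w - y r) <= v w - v (y s).
Proof.
move=> e0; have cy := curve_continuous cyz.
have [d d0 dP] := running_near (y s) e0.
exists (d / 3) => [|r w r0 sdr rs wd]; first exact: divr_gt0.
have sd3 u : r <= u -> s - u < d by move=> ru; lra.
have h4 : v (y r) <= (l (y s) + e) * enorm (w - y r) + v w.
  apply: value_segment => x xr; have /dP/andP[] // : enorm (x - y s) < d.
  have h5 := curve_dist_le cyz (ltW rs).
  have h6 := enorm_distD (y r) x (y s).
  have h7 := enorm_distD (y s) w (y r).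
  rewrite (enormC (y s)) in h7.
  move: xr sdr wd h5 h6 h7.
  move: (enorm (x - y r)) (enorm (w - y r)) (enorm (w - y s)).
  move: (enorm (y r - y s)) (enorm (x - y s)) => a b c f g; lra.
have h3 : (l (y s) - e) * (s - r) <= running_cost y s - running_cost y r.
  apply: running_cost_diff_ge => // [|u /andP[ru us]]; first exact: ltW.
  have /dP/andP[] // : enorm (y u - y s) < d.
  by apply: le_lt_trans (curve_dist_le cyz us) (sd3 u ru).
have h1 := dynamic_programming_le cyz r0.
have h2 := dynamic_programming_ge cyz (ltW s0) ys yz.
move: h1 h2 h3 h4; move: (running_cost y s) (running_cost y r) (_ * enorm _).
move: (v z) (v w) (v (y s)) (v (y r)) (_ * (s - r)) => a b c f g h i j; lra.
Qed.

Let expansion e : 0 < e -> exists2 d, 0 < d & forall r, s - d < r -> r < s ->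
  enorm (y r - y s + (s - r) *: q) <= e * (s - r).
Proof.
move=> e0; have [d d0 dP] := derivable_expansion dys e0.
exists d => // r sdr rs; have := dP r.
rewrite distrC gtr0_norm ?subr_gt0// -[r - s]opprB scaleNr opprK; apply.
by rewrite ltrBlDr -ltrBlDl.
Qed.

Lemma optimal_unit_speed : enorm q = 1.
Proof.
have L0 := lpos Ms.
apply/le_anti/andP; split.
  apply/ler_addgt0Pr => e e0; have [d d0 dP] := expansion e0.
  have [k [k0 kd ks]] := exists_lt_both d0 s0.
  have rs : s - k < s by rewrite gtrBl.
  have := dP (s - k); rewrite subKr ltrD2l ltrN2 => /(_ kd rs) h1.
  have := curve_dist_le cyz (ltW rs); rewrite subKr => h2.
  have := enorm_triangle (y (s - k) - y s + k *: q) (- (y (s - k) - y s)).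
  rewrite enormN addrAC subrr add0r enormZ gtr0_norm// => h3.
  rewrite -(ler_pM2l k0) (le_trans h3)// mulrDr mulr1 addrC lerD// mulrC.
  exact: h1.
(* With speed below 1, the segment from [y (s - k)] straight to [y s] would be cheaper. The
   comparison gives [L * (1 - enorm q) <= e * (1 + L + enorm q + e)] for [L = l (y s)], which is
   below [e * (L + 3)], against the choice of [e]. *)
rewrite leNgt; apply/negP => q1.
have L3 : 0 < l (y s) + 3 by rewrite addr_gt0.
have [e [e0 e1 eL]] : exists e, [/\ 0 < e, e < 1 &
    e < l (y s) * (1 - enorm q) / (l (y s) + 3)].
  by apply: exists_lt_both => //; rewrite divr_gt0// mulr_gt0// subr_gt0.
rewrite ltr_pdivlMr// in eL.
have [d d0 dP] := expansion e0.
have [d' d'0 d'P] := segment_comparison e0.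
have [t [t0 td td']] := exists_lt_both d0 d'0.
have [k [k0 kt ks]] := exists_lt_both t0 s0.
have rs : s - k < s by rewrite gtrBl.
have := dP (s - k); rewrite subKr ltrD2l ltrN2.
move=> /(_ (lt_trans kt td) rs) h1.
have := d'P (s - k) (y s); rewrite subKr !subrr enorm0 ltrD2l ltrN2 subr_ge0.
move=> /(_ (ltW ks) (lt_trans kt td') rs d'0) h2.
have h3 : enorm (y s - y (s - k)) <= k * enorm q + e * k.
  have := enorm_triangle (- (y (s - k) - y s + k *: q)) (k *: q).
  rewrite enormN opprD subrK opprB enormZ gtr0_norm// => h3.
  by rewrite (le_trans h3)// addrC lerD2l.
have h4 : (l (y s) + e) * enorm (y s - y (s - k)) <=
    (l (y s) + e) * (k * enorm q + e * k) by rewrite ler_wpM2l// addr_ge0 ?ltW.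
have : (l (y s) - e) * k <= (l (y s) + e) * (enorm q + e) * k.
  rewrite -mulrA [(enorm q + e) * k]mulrDl (mulrC (enorm q)).
  by move: h2; rewrite subr_le0 => /le_trans; apply.
rewrite ler_pM2r//.
have h5 : e * enorm q < e * 1 by rewrite ltr_pM2l.
have h6 : e * e < e * 1 by rewrite ltr_pM2l.
move: eL h5 h6; move: (l (y s)) (enorm q) => a b; lra.
Qed.

(* [subgradient_estimate] is applied with [s - r] equal to [A] times the distance
   from [w] to [y s]: the second-order term of [enorm_perturbation] is then of
   order [1 / A], and the remaining errors are made small after [A] is fixed. *)
Lemma optimal_subgradient : subdiff v (y s) (- l (y s) *: q).
Proof.
have L0 := lpos Ms; set L := l (y s) in L0 *.
have q1 := optimal_unit_speed.
apply/subdiffP => eta eta0.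
(* The summand 1 gives [enorm u <= k], as [enorm_perturbation] requires; the other makes the
   quadratic error, [enorm u / (2 * A)], at most [eta / 2 * enorm u] after multiplication by
   [L + 1]. *)
pose A := 1 + (L + 1) / eta.
have A1 : 1 <= A by rewrite lerDl divr_ge0// ?addr_ge0// ltW.
have A0 : 0 < A by exact: lt_le_trans A1.
have LA : L + 1 <= eta * A.
  by rewrite mulrDr mulr1 mulrC divfK ?gt_eqF// lerDr ltW.
have B0 : 0 < 2 * A + 1 + (L + 1) * A.
  by rewrite addr_gt0// ?mulr_gt0// addr_gt0// mulr_gt0.
have [e [e0 e1 eB]] : exists e, [/\ 0 < e, e < 1 &
    e < eta / 2 / (2 * A + 1 + (L + 1) * A)].
  by apply: exists_lt_both => //; rewrite !divr_gt0.
rewrite ltr_pdivlMr// in eB.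
have [d d0 dP] := expansion e0.
have [d' d'0 d'P] := segment_comparison e0.
have [t [t0 td td']] := exists_lt_both d0 d'0.
have [t1 [t10 t1t t1s]] := exists_lt_both t0 s0.
(* This radius ensures [k = A * enorm u < t1], so [s - k] is positive and within reach of both local
   estimates. *)
exists (t1 / A); first exact: divr_gt0.
move=> w wd; set u := w - y s in wd *.
have [u0|u0] := eqVneq u 0.
  move: (u0) => /eqP; rewrite subr_eq0 => /eqP ->.
  by rewrite u0 dotr0 enorm0 mulr0 !subrr.
have du0 : 0 < enorm u by rewrite enorm_gt0.
pose k := A * enorm u.
have k0 : 0 < k by exact: mulr_gt0.
have kt1 : k < t1 by rewrite /k mulrC -ltr_pdivlMr.
have uk : enorm u <= k by rewrite ler_peMl.
have rs : s - k < s by rewrite gtrBl.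
have := dP (s - k); rewrite subKr ltrD2l ltrN2.
move=> /(_ (lt_trans kt1 (lt_trans t1t td)) rs) h1.
have := d'P (s - k) w; rewrite subKr ltrD2l ltrN2 subr_ge0 -/u -/L.
move=> /(_ (ltW (lt_trans kt1 t1s)) (lt_trans kt1 (lt_trans t1t td')) rs).
move=> /(_ (le_lt_trans uk (lt_trans kt1 (lt_trans t1t td')))) h2.
have h3 := enorm_perturbation q1 k0 uk.
have h4 : enorm (w - y (s - k)) <=
    k + dot q u + enorm u ^+ 2 / (2 * k) + e * k.
  have := enorm_triangle (u + k *: q) (- (y (s - k) - y s + k *: q)).
  rewrite enormN opprD opprB addrACA subrr addr0 {1}/u addrA subrK => h4.
  by rewrite (le_trans h4)// lerD.
rewrite dotZl mulNr.
apply: (subgradient_estimate (ltW L0) (ltW du0) e0 (ltW e1) (ltW A0) (ltW eB)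
  _ _ (erefl k) _ h4 h2).
- by rewrite divr_ge0 ?sqr_ge0// mulr_ge0// ltW.
- rewrite mulrA ler_pdivrMr ?mulr_gt0//.
  have : (L + 1) * (enorm u * enorm u) <= eta * A * (enorm u * enorm u).
    by rewrite ler_wpM2r// mulr_ge0.
  by clear h1 h2 h3 h4; rewrite /k expr2; move: (enorm u) => b; lra.
- rewrite ler_norml (le_trans (le_dot_enorm _ _)) ?q1 ?mul1r// andbT.
  by rewrite lerNl -dotNl (le_trans (le_dot_enorm _ _))// enormN q1 mul1r.
Qed.

Lemma descent_of_optimal : descent_directions v (y s) q.
Proof.
have L0 := lpos Ms.
exists (- l (y s) *: q).
  split; first exact: optimal_subgradient.
  by rewrite -enorm_eq0 enormZ optimal_unit_speed mulr1 normrN normr_eq0 gt_eqF.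
rewrite enormZ optimal_unit_speed mulr1 normrN gtr0_norm// scalerA.
by rewrite mulrNN mulVf ?gt_eqF// scale1r.
Qed.

End optimal_descent.

End running_cost.

(** Both measures have the same negligible sets: a Lebesgue null set has outer measure zero, hence
    lies in a Borel null set. *)
Lemma ae_lebesgueR (R : realType) (P : R -> Prop) :
  {ae lebesgue R, forall s : R, P s} <->
  {ae @lebesgue_measure R, forall s : R, P s}.
Proof.
split=> -[A [mA A0 PA]].
- have [B [mB B0 AB]] := (negligible_outer_measure A).2 A0.
  by exists B; split => //; exact: subset_trans AB.
- by exists A; split => //; exact: sub_caratheodory.
Qed.

(* [value M l] is finite everywhere under the hypotheses (straight lines reach
   the nonempty set M at finite cost), so [fine] only changes its type. *)
Theorem theorem3p3 (R : realType) (n : nat) (M : set 'rV[R]_n)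
    (l : 'rV[R]_n -> R) (M0 : M !=set0) (Mclosed : closed M)
    (lcont : continuous l) (lbounded : exists C : R, forall z, `|l z| <= C)
    (lpos : forall z, ~ M z -> 0 < l z) (lzero : forall z, M z -> l z = 0)
    (x : 'rV[R]_n) (a : R -> 'rV[R]_n) (ha : admissible a) :
  let y := trajectory x a in
  let v := fun z => fine (value M l z) in
  optimal M l x a <->
  {ae lebesgue R, forall s : R, 0 < s -> (s%:E < hitting_time M x a)%E ->
     derivable y s 1 /\ descent_directions v (y s) (derive1 y s)}.
Proof.
move=> y v.
have cyx : curve x y by exists a.
have hitP := fun s => lt_hitting_time Mclosed s (curve_continuous cyx).
split=> [/(optimalP M0 Mclosed lcont lbounded lpos lzero _ ha) oy|yN].
  apply/ae_lebesgueR; have := curve_derivable cyx.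
  apply: filterS;
  first exact: (ae_filter_ringOfSetsType lebesgue_measure).
  move=> s dy s0 /hitP ys; have dys := dy s0; split => //.
  exact: (descent_of_optimal M0 Mclosed lcont lbounded lpos lzero cyx s0 ys dys oy).
apply/(optimalP M0 Mclosed lcont lbounded lpos lzero _ ha).
apply: (optimal_of_descent M0 Mclosed lcont lbounded lpos lzero cyx).
move/ae_lebesgueR : yN; apply: filterS;
  first exact: (ae_filter_ringOfSetsType lebesgue_measure).
by move=> s h s0 /hitP; exact: h.
Qed.
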